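(* Let $\{\mathbf{s}_1,\dots,\mathbf{s}_M\}\subset\mathbb{R}^n$, $n\ge1$, be any constellation of $M\ge2$ distinct points used over the AWGN channel with maximum-likelihood detection, and let $d_{\min}=\frac12\min_{i\ne j}|\mathbf{s}_i-\mathbf{s}_j|$. On the range of SNR $$\gamma\ge (n+\sqrt{2n})/d_{\min}^2 ,$$ all pairwise error probabilities $\Pr\{\mathbf{s}_i\to\mathbf{s}_j\}$, $i\ne j$, and also the bit error rate (for any bit mapping) are convex functions of $\gamma$.
   Context: Setting: a constellation is a set of $M\ge2$ distinct points $\mathbf{s}_1,\dots,\mathbf{s}_M\in\mathbb{R}^n$, normalized by $\frac1M\sum_{i=1}^M|\mathbf{s}_i|^2=1$ ($|\cdot|$ is the Euclidean norm). The received vector is $\mathbf{r}=\mathbf{s}+\boldsymbol{\xi}$, where $\mathbf{s}$ is a random constellation point with prior probabilities $\Pr[\mathbf{s}=\mathbf{s}_i]\ge0$ summing to 1 (not depending on the noise), $\boldsymbol\xi\sim\mathcal N(\mathbf 0,\sigma_0^2\mathbf I)$ is independent of $\mathbf{s}$, and the SNR is $\gamma=1/\sigma_0^2>0$. The maximum-likelihood detector outputs $\hat{\mathbf{s}}=\arg\min_{\mathbf{s}_k}|\mathbf{r}-\mathbf{s}_k|$. The pairwise error probability is $\Pr\{\mathbf{s}_i\to\mathbf{s}_j\}=\Pr[\hat{\mathbf{s}}=\mathbf{s}_j\mid\mathbf{s}=\mathbf{s}_i]$, i.e. the probability that $\mathbf{s}_i+\boldsymbol\xi$ lies in the Voronoi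 region of $\mathbf{s}_j$ with respect to the whole constellation. A bit mapping assigns distinct binary sequences of length $\log_2M$ to the constellation points ($M$ a power of 2 when the BER is considered). With $h_{ij}$ the Hamming distance between the binary sequences of $\mathbf{s}_i$ and $\mathbf{s}_j$, the bit error rate is $\mathrm{BER}=\sum_{i=1}^M\sum_{j\ne i}\frac{h_{ij}}{\log_2M}\Pr[\mathbf{s}=\mathbf{s}_i]\Pr\{\mathbf{s}_i\to\mathbf{s}_j\}$. *)

(* Defs.v *)
From HB Require Import structures.
From mathcomp Require Import all_boot all_order all_algebra.
From mathcomp Require Import all_classical all_reals all_analysis.

Set Implicit Arguments.
Unset Strict Implicit.
Unset Printing Implicit Defensive.

Import Order.TTheory GRing.Theory Num.Theory.
Import numFieldNormedType.Exports.

Local Open Scope classical_set_scope.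
Local Open Scope ring_scope.

(* The n-fold product P \x ... \x P, i.e. the law of n i.i.d. samples from P. *)
Section power_probability.
Context d (T : measurableType d) (R : realType) (P : probability T R).

Definition cons_pair n (x : T * n.-tuple T) : n.+1.-tuple T :=
  [tuple of x.1 :: x.2].

Lemma measurable_cons_pair n : measurable_fun [set: T * n.-tuple T] (@cons_pair n).
Proof. exact: measurable_cons measurable_fst measurable_snd. Qed.

HB.instance Definition _ n :=
  isMeasurableFun.Build _ _ _ _ (@cons_pair n) (@measurable_cons_pair n).

Fixpoint power_prob n : probability (n.-tuple T) R :=
  match n with
  | 0 => dirac [tuple]
  | m.+1 => distribution (P \x power_prob m)%E (@cons_pair m)
  end.

Lemma power_prob_box n (A : 'I_n -> set T) : (forall i, measurable (A i)) ->
  power_prob n [set t | forall i, A i (tnth t i)] = (\prod_(i < n) P (A i))%E.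
Proof.
elim: n A => [|n IHn] A mA.
  rewrite big_ord0 /= diracE mem_set //= => -[] //.
rewrite big_ord_recl -IHn; last by move=> i; exact: mA.
rewrite /= /distribution /pushforward.
rewrite -product_measure1E //; last first.
  rewrite (_ : [set _ | _] = \big[setI/setT]_(i < n)
      ((fun t : n.-tuple T => tnth t i) @^-1` A (lift ord0 i))).
    apply: bigsetI_measurable => i _; rewrite -[X in measurable X]setTI.
    exact: measurable_tnth.
  apply/seteqP; split=> t /=.
    by move=> h; rewrite -bigcap_seq => i _; exact: h.
  by rewrite -bigcap_seq => h i; apply: h; rewrite /= mem_index_enum.
congr (_ _); apply/seteqP; split=> -[x t] /=.
  move=> h; split; first exact: (h ord0).
  by move=> i; have := h (lift ord0 i); rewrite /cons_pair /= tnthS.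
move=> [h0 h] i; case: (unliftP ord0 i) => [j|] ->; last exact: h0.
by rewrite /cons_pair /= tnthS; exact: h.
Qed.

End power_probability.

Section awgn.
Context {R : realType} {n : nat}.

(* The library's norm `|v| on 'rV[R]_n is the sup norm. *)
Definition enorm (v : 'rV[R]_n) : R := Num.sqrt (\sum_(k < n) v 0 k ^+ 2).

(* N(0, sigma^2 I); n.-tuple R carries the Borel sigma-algebra of R^n. *)
Definition noise (sigma : R) : probability (n.-tuple (measurableTypeR R)) R :=
  power_prob (normal_prob 0 sigma) n.

Definition vec (t : n.-tuple R) : 'rV[R]_n := \row_k tnth t k.

Section constellation.
Context {M : nat} (s : 'I_M -> 'rV[R]_n).

Definition is_constellation :=
  injective s /\ M%:R^-1 * (\sum_(i < M) enorm (s i) ^+ 2) = 1.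

(* For M >= 2 this is an infimum over a finite nonempty set, hence a minimum. *)
Definition dmin : R :=
  2^-1 * inf [set enorm (s p.1 - s p.2) | p in [set p : 'I_M * 'I_M | p.1 != p.2]].

(* Where the maximum-likelihood detector outputs s j; ties between regions form
   a null set. *)
Definition voronoi (j : 'I_M) : set 'rV[R]_n :=
  [set r | forall k : 'I_M, enorm (r - s j) <= enorm (r - s k)].

(* The SNR is gamma = 1 / sigma0^2. *)
Definition pep (i j : 'I_M) (gamma : R) : R :=
  fine (noise (Num.sqrt gamma)^-1 [set xi | voronoi j (s i + vec xi)]).

Definition is_prior (p : 'I_M -> R) :=
  (forall i, 0 <= p i) /\ \sum_(i < M) p i = 1.

Definition hamming m (u v : m.-tuple bool) : nat :=
  #|[set k : 'I_m | tnth u k != tnth v k]%SET|.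

(* m is the number log2 M of bits per point. *)
Definition ber m (b : 'I_M -> m.-tuple bool) (p : 'I_M -> R) (gamma : R) : R :=
  \sum_(i < M) \sum_(j < M | j != i)
    (hamming (b i) (b j))%:R / m%:R * p i * pep i j gamma.

End constellation.
End awgn.

(* Main.v *)
(* On the event s_i -> s_j the noise satisfies |xi| >= |s_i - s_j| / 2 >= dmin.
   For |xi| >= dmin and gamma >= (n + sqrt(2n)) / dmin^2, the Gaussian density
   at xi is a convex function of gamma, and integrating over the event preserves
   convexity, so that no differentiation under the integral sign is needed.
   Densities are taken with respect to the unit-variance noise rather than to
   n-dimensional Lebesgue measure. *)
Require Import Defs.
From mathcomp Require Import all_boot all_order all_algebra.
From mathcomp Require Import all_classical all_reals all_analysis.
From mathcomp Require Import measurable_realfun ring lra.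

Import Order.TTheory GRing.Theory Num.Theory.
Import numFieldNormedType.Exports.

Set Implicit Arguments.
Unset Strict Implicit.
Unset Printing Implicit Defensive.

Local Open Scope classical_set_scope.
Local Open Scope ring_scope.
Local Open Scope convex_scope.

(** * Convexity of z^c e^(-a z) on the positive half-line *)

Section gamma_density_convexity.
Variables (R : realType) (c a : R).

(** For z > 0 this is z^c e^(-a z); in exponential form its logarithmic derivative c/z - a is
    immediate. *)
Let f (z : R) : R := expR (c * ln z - a * z).

Let is_derive_f (z : R) : 0 < z -> is_derive z 1 f (f z * (c / z - a)).
Proof.
move=> z0.
have dln : is_derive z 1 (@ln R) z^-1 by exact: is_derive1_ln.
have dexpo : is_derive z 1 (fun z : R => c * ln z - a * z) (c / z - a).
  by apply: is_derive_eq; rewrite /GRing.scale/=; ring.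
exact: (@is_derive1_comp _ expR (fun z => c * ln z - a * z)).
Qed.

Let is_derive2_f (z : R) : 0 < z ->
  is_derive z 1 ('D_1 f) (f z * ((c / z - a) ^+ 2 - c / z ^+ 2)).
Proof.
move=> z0; have zn0 : z != 0 by rewrite gt_eqF.
(* The formula for the first derivative is known only at positive points, hence the equality only
   near [z]. *)
have Df : {near z, (fun z => f z * (c / z - a)) =1 'D_1 f}.
  near=> w; have w0 : 0 < w by near: w; exact: lt_nbhsr.
  by have [_ ->] := is_derive_f w0.
apply: (near_eq_is_derive Df).
have df := is_derive_f z0.
have dV := @is_deriveV _ id z 1 1 zn0 (is_derive_id _ _).
by apply: is_derive_eq; rewrite /GRing.scale/=; field.
Unshelve. all: by end_near.
Qed.

(** Since z^2 f''(z) = f(z) ((a z - c)^2 - c), the last hypothesis makes the second derivative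
    nonnegative between x and y. *)
Lemma convex_expR_ln_sub (x y : R) (t : {i01 R}) : 0 < x -> x <= y ->
  (forall z, x < z -> c <= (a * z - c) ^+ 2) ->
  f ((x : R^o) <| t |> (y : R^o)) <= (f x : R^o) <| t |> (f y : R^o).
Proof.
move=> x0 xy cle.
have gt0 z : z \in `]x, y[ -> 0 < z.
  by rewrite in_itv/= => /andP[xz _]; exact: lt_trans xz.
have cvgf (z : R) : 0 < z -> {for z, continuous f}.
  by move=> z0; apply/differentiable_continuous/derivable1_diffP;
    have [] := is_derive_f z0.
apply: second_derivative_convex => //.
- move=> z xzy; have z0 := gt0 z xzy; have [_ ->] := is_derive2_f z0.
  rewrite mulr_ge0 ?expR_ge0//.
  have -> : (c / z - a) ^+ 2 - c / z ^+ 2 = ((a * z - c) ^+ 2 - c) / z ^+ 2.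
    by field; rewrite gt_eqF.
  rewrite divr_ge0 ?sqr_ge0// subr_ge0 cle//.
  by have /andP[] := xzy.
- exact/cvg_at_left_filter/cvgf/(lt_le_trans x0).
- exact/cvg_at_right_filter/cvgf.
- by move=> z /gt0 /is_derive_f[].
- by move=> z /gt0 /is_derive2_f[].
Qed.

End gamma_density_convexity.

(* With u = a z, the second derivative of z^(n/2) e^(-a z) has the sign of
   (u - n/2)^2 - n/2, hence is nonnegative once 2u >= n + sqrt(2n). *)
Lemma convex_sqrtrX_expR {R : realType} (n : nat) (a x y : R) (t : {i01 R}) :
  let f z := Num.sqrt z ^+ n * expR (- (a * z)) in
  0 < x -> 0 < y ->
  n%:R + Num.sqrt (2 * n%:R) <= 2 * a * x ->
  n%:R + Num.sqrt (2 * n%:R) <= 2 * a * y ->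
  f ((x : R^o) <| t |> (y : R^o)) <= (f x : R^o) <| t |> (f y : R^o).
Proof.
move=> f; wlog xy : x y t / x <= y.
  move=> H x0 y0 nx ny; have [xy|/ltW yx] := leP x y; first exact: H.
  by rewrite convC [leRHS]convC; exact: H.
move=> x0 y0 nx _.
have fE z : 0 < z -> f z = expR (n%:R / 2 * ln z - a * z).
  move=> z0; rewrite expRD; congr (_ * _).
  rewrite -powR12_sqrt ?ltW// -powR_mulrn ?powR_ge0// -powRrM.
  by rewrite /powR gt_eqF//; congr (expR _); field.
rewrite fE ?convR_gt0// !fE//.
apply: convex_expR_ln_sub => // z xz.
set q := Num.sqrt _ in nx; have q0 : 0 <= q := sqrtr_ge0 _.
have q2 : q ^+ 2 = 2 * n%:R by rewrite sqr_sqrtr ?mulr_ge0.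
have n0 : (0 : R) <= n%:R by [].
have a0 : 0 <= a by rewrite -(pmulr_lge0 _ x0); lra.
have axz : a * x <= a * z by rewrite ler_wpM2l// ltW.
(* With c = n/2 and q^2 = 2n, this is four times the required c <= (a z - c)^2; it follows from n +
   q <= 2 a x <= 2 a z. *)
have : q ^+ 2 <= (2 * (a * z) - n%:R) ^+ 2.
  by rewrite lerXn2r ?nnegrE//; lra.
by rewrite q2 => h; nra.
Qed.

(** * Integration against measures with densities, and their powers *)

Section change_of_density.
Context d (T : measurableType d) (R : realType).
Local Open Scope ereal_scope.

(** The Radon-Nikodym derivative of [P] has the same integral as [f] over every measurable set, so
    the two agree almost everywhere, and its change of variables formula transfers to [f]. *)
Lemma ge0_integral_density (P : probability T R)
    (mu : {sigma_finite_measure set T -> \bar R}) (f : T -> R) :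
  (forall x, 0 <= f x)%R -> measurable_fun setT f ->
  (forall A, measurable A -> P A = \int[mu]_(x in A) (f x)%:E) ->
  forall g : T -> \bar R, (forall x, 0 <= g x) ->
  measurable_fun [set: T] g ->
  \int[P]_x g x = \int[mu]_x (g x * (f x)%:E).
Proof.
move=> f0 mf Pf g g0 mg.
have mfE : measurable_fun setT (EFin \o f) by exact/measurable_EFinP.
have Pmu : P `<< mu.
  apply/null_content_dominatesP => A mA muA0.
  by rewrite Pf//; apply: null_set_integral => //; exact: measurable_funTS.
pose h := Radon_Nikodym_SigmaFinite.f P mu.
have hi : mu.-integrable setT h.
  exact: Radon_Nikodym_SigmaFinite.f_integrable.
have hf : ae_eq mu setT h (EFin \o f).
  apply: integral_ae_eq => // A _ mA.
  rewrite -Radon_Nikodym_SigmaFinite.f_integral//; exact: Pf.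
rewrite -(Radon_Nikodym_SigmaFinite.change_of_variables Pmu)//.
apply: ae_eq_integral => //.
- by apply: emeasurable_funM => //; exact: measurable_int hi.
- exact: emeasurable_funM.
- exact: ae_eqe_mul2l.
Qed.

(** Induction on n: Tonelli splits off the first coordinate, which is handled by the one-variable
    density, and the remaining ones by the induction hypothesis. *)
Lemma ge0_integral_power_prob (P Q : probability T R) (f : T -> R) n :
  (forall x, 0 <= f x)%R -> measurable_fun setT f ->
  (forall A, measurable A -> Q A = \int[P]_(x in A) (f x)%:E) ->
  forall g : n.-tuple T -> \bar R, (forall t, 0 <= g t) ->
  measurable_fun [set: n.-tuple T] g ->
  \int[power_prob Q n]_t g t =
  \int[power_prob P n]_t (g t * (\prod_(i < n) f (tnth t i))%:E).
Proof.
move=> f0 mf Qf; elim: n => [|n IHn] g g0 mg.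
  by apply: eq_integral => t _; rewrite big_ord0 mule1.
have mF k : measurable_fun setT
    (fun t : k.-tuple T => (\prod_(i < k) f (tnth t i))%:E).
  apply/measurable_EFinP/measurable_prod => i _.
  by apply: measurableT_comp => //; exact: measurable_tnth.
have F0 k (t : k.-tuple T) : (0 <= \prod_(i < k) f (tnth t i))%R.
  by apply: prodr_ge0.
have mcons := @measurable_cons_pair _ T n.
have mgc : measurable_fun setT (g \o @cons_pair _ T n).
  exact: measurableT_comp.
have mgF : measurable_fun setT
    (fun t : n.+1.-tuple T => g t * (\prod_(i < n.+1) f (tnth t i))%:E).
  exact: emeasurable_funM mg (mF _).
have gF0 (t : n.+1.-tuple T) : 0 <= g t * (\prod_(i < n.+1) f (tnth t i))%:E.
  by rewrite mule_ge0// lee_fin F0.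
have mgx x : measurable_fun setT (fun t => g (@cons_pair _ T n (x, t))).
  exact: measurableT_comp mgc (pair1_measurable x).
rewrite /= !ge0_integral_distribution//.
rewrite fubini_tonelli1//; last by move=> t; exact: g0.
rewrite fubini_tonelli1//; last 2 first.
- exact: measurableT_comp.
- by move=> t; exact: gF0.
rewrite (ge0_integral_density f0 mf Qf); last 2 first.
- by move=> x; apply: integral_ge0 => y _; exact: g0.
- by apply: measurable_fun_fubini_tonelli_F => // t; exact: g0.
apply: eq_integral => x _; rewrite /fubini_F IHn//; last 2 first.
- by move=> t; exact: g0.
- exact: mgx.
(* The factor [f x] of the first coordinate moves inside the inner integral to complete the
   product. *)
rewrite -ge0_integralZr ?lee_fin//; last 2 first.
- exact: emeasurable_funM (mgx x) (mF _).
- by move=> y _; rewrite mule_ge0 ?lee_fin ?F0//; exact: g0.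
apply: eq_integral => t _ /=.
rewrite big_ord_recl -muleA -EFinM mulrC; congr (_ * (_ * _)%:E).
by apply: eq_bigr => i _; rewrite /cons_pair tnthS.
Qed.

End change_of_density.

(** * The Euclidean norm *)

Section euclidean_norm.
Context {R : realType} {n : nat}.
Implicit Types u v : 'rV[R]_n.

Lemma enorm_ge0 v : 0 <= enorm v. Proof. exact: sqrtr_ge0. Qed.

Lemma sqr_enorm v : enorm v ^+ 2 = \sum_(k < n) v 0 k ^+ 2.
Proof. by rewrite sqr_sqrtr// sumr_ge0// => k _; rewrite sqr_ge0. Qed.

Lemma enorm_gt0 v : v != 0 -> 0 < enorm v.
Proof.
move=> v0; rewrite lt_neqAle enorm_ge0 andbT eq_sym; apply: contra v0.
rewrite -sqrf_eq0 sqr_enorm psumr_eq0 => [/allP v0|k _]; last exact: sqr_ge0.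
apply/eqP/rowP => k; rewrite mxE; apply/eqP; rewrite -sqrf_eq0.
by apply: v0; rewrite mem_index_enum.
Qed.

Lemma sqr_enormB_le u v :
  enorm (u - v) ^+ 2 <= 2 * enorm u ^+ 2 + 2 * enorm v ^+ 2.
Proof.
rewrite !sqr_enorm !mulr_sumr -big_split/= ler_sum// => k _; rewrite !mxE.
have := sqr_ge0 (u 0 k + v 0 k); nra.
Qed.

Lemma measurable_enorm d (T : measurableType d) (f : T -> 'rV[R]_n) :
  (forall k, measurable_fun setT (fun x => f x 0 k)) ->
  measurable_fun setT (fun x => enorm (f x)).
Proof.
move=> mf; apply: measurableT_comp => //.
  exact: continuous_measurable_fun (@sqrt_continuous R).
by apply: measurable_sum => k; exact: measurable_funX.
Qed.

Lemma measurable_enorm_vec : measurable_fun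
  [set: n.-tuple (measurableTypeR R)] (fun xi => enorm (vec xi) : R).
Proof.
apply: measurable_enorm => k; under eq_fun do rewrite mxE.
exact: measurable_tnth.
Qed.

End euclidean_norm.

(** * Minimum distance and the size of the noise on an error event *)

Section minimum_distance.
Context {R : realType} {n M : nat} (s : 'I_M -> 'rV[R]_n).

(** Some pair of distinct indices minimizes the distance among the finitely many, and its positive
    distance bounds the infimum from below. *)
Lemma dmin_gt0 : injective s -> (2 <= M)%N -> 0 < dmin s.
Proof.
case: M s => [//|[//|m]] s' s'_inj _; rewrite mulr_gt0//.
pose dist (p : 'I_m.+2 * 'I_m.+2) := enorm (s' p.1 - s' p.2).
pose p0 : 'I_m.+2 * 'I_m.+2 := (ord0, ord_max).
have p012 : p0.1 != p0.2 by [].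
case: (@Order.TotalTheory.arg_minP _ _ _ p0
  (fun p : 'I_m.+2 * 'I_m.+2 => p.1 != p.2) dist p012) => p p12 p_min.
apply: (@lt_le_trans _ _ (dist p)).
  by rewrite enorm_gt0// subr_eq0 (inj_eq s'_inj).
apply: lb_le_inf; first by exists (dist p), p.
by move=> _ [q q12 <-]; exact: p_min.
Qed.

Lemma dmin_le i j : i != j -> dmin s <= 2^-1 * enorm (s i - s j).
Proof.
move=> ij; rewrite ler_pM2l//; apply: ge_inf.
  by exists 0 => _ [p _ <-]; exact: enorm_ge0.
by exists (i, j).
Qed.

(** Comparing s_j with the competitor s_i gives |s_i + xi - s_j| <= |xi|, so s_i and s_j are at most
    2|xi| apart. *)
Lemma dmin_le_voronoi i j (xi : 'rV[R]_n) : i != j -> injective s ->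
  (2 <= M)%N -> voronoi s j (s i + xi) -> dmin s ^+ 2 <= enorm xi ^+ 2.
Proof.
move=> ij s_inj M2 /(_ i).
have -> : s i + xi - s i = xi by rewrite addrC addKr.
move=> le_xi.
have dij := dmin_le ij; have d0 := dmin_gt0 s_inj M2.
(* |s_i - s_j|^2 <= 2|s_i + xi - s_j|^2 + 2|xi|^2 <= 4|xi|^2, which avoids the
   triangle inequality for enorm. *)
have := sqr_enormB_le (s i + xi - s j) xi.
rewrite addrAC addrK => tri.
have h : enorm (s i + xi - s j) ^+ 2 <= enorm xi ^+ 2.
  by rewrite lerXn2r ?nnegrE ?enorm_ge0.
have : dmin s ^+ 2 <= (2^-1 * enorm (s i - s j)) ^+ 2.
  by rewrite lerXn2r// nnegrE ?(ltW d0)// mulr_ge0 ?enorm_ge0.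
rewrite exprMn => h2; lra.
Qed.

Lemma measurable_voronoi i j : measurable
  [set xi : n.-tuple (measurableTypeR R) | voronoi s j (s i + vec xi)].
Proof.
have -> : [set xi : n.-tuple (measurableTypeR R) | voronoi s j (s i + vec xi)] =
    \bigcap_(k in [set: 'I_M])
      [set xi | enorm (s i + vec xi - s j) <= enorm (s i + vec xi - s k)].
  by apply/seteqP; split=> xi /= h k; [move=> _|]; exact: h.
apply: fin_bigcap_measurable => // k _.
have mdist l : measurable_fun [set: n.-tuple (measurableTypeR R)]
    (fun xi => enorm (s i + vec xi - s l)).
  apply: measurable_enorm => l'; under eq_fun do rewrite !mxE.
  apply: measurable_funB => //; apply: measurable_funD => //.
  exact: measurable_tnth.
rewrite -[X in measurable X]setTI; exact: measurable_fun_le.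
Qed.

End minimum_distance.

(** * Density of the noise relative to unit-variance noise *)

Section noise_density.
Context {R : realType}.

(** The peak scales by sqrt(gamma), and the exponent splits as gamma x^2/2 = (gamma - 1) x^2/2 +
    x^2/2. *)
Lemma normal_pdf_snr (gamma x : R) : 0 < gamma ->
  normal_pdf 0 (Num.sqrt gamma)^-1 x =
  Num.sqrt gamma * expR (- ((gamma - 1) / 2 * x ^+ 2)) * normal_pdf 0 1 x.
Proof.
move=> g0; have s0 : 0 < Num.sqrt gamma by rewrite sqrtr_gt0.
have peakE :
    normal_peak (Num.sqrt gamma)^-1 = Num.sqrt gamma * normal_peak (1 : R).
  rewrite /normal_peak expr1n mul1r exprVn sqr_sqrtr ?ltW// -mulrnAr.
  by rewrite sqrtrM ?invr_ge0 ?ltW// sqrtrV ?ltW// invfM invrK.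
rewrite !normal_pdfE ?invr_eq0 ?gt_eqF// peakE -!mulrA; congr (_ * _).
rewrite mulrCA; congr (_ * _); rewrite /normal_fun -expRD; congr expR.
by rewrite subr0 expr1n exprVn sqr_sqrtr ?ltW//; field; rewrite gt_eqF.
Qed.

Lemma normal_prob_snr (gamma : R) (A : set R) : 0 < gamma -> measurable A ->
  (normal_prob 0 (Num.sqrt gamma)^-1 A = \int[normal_prob 0 1]_(x in A)
    (Num.sqrt gamma * expR (- ((gamma - 1) / 2 * x ^+ 2)))%:E)%E.
Proof.
move=> g0 mA.
pose f (x : R) := Num.sqrt gamma * expR (- ((gamma - 1) / 2 * x ^+ 2)).
have f0 x : 0 <= f x by rewrite mulr_ge0 ?expR_ge0 ?sqrtr_ge0.
have mf : measurable_fun setT f.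
  apply: measurable_funM => //; apply: measurableT_comp => //.
  apply: measurableT_comp => //; exact: measurable_funM.
rewrite integral_mkcond.
rewrite (@ge0_integral_density _ _ _ (normal_prob 0 1 : probability _ _)
  lebesgue_measure (normal_pdf 0 1))//; last 4 first.
- by move=> x; exact: normal_pdf_ge0.
- exact: measurable_normal_pdf.
- by move=> x; apply: erestrict_ge0 => y _; rewrite lee_fin.
- by apply/(measurable_restrictT _ mA)/measurable_funTS/measurable_EFinP.
rewrite /normal_prob integral_mkcond; apply: eq_integral => x _.
rewrite !patchE; case: ifPn => _; last by rewrite mul0e.
by rewrite normal_pdf_snr// EFinM.
Qed.

End noise_density.

(** Multiplying the coordinate densities and splitting off e^(|xi|^2/2), which is free of gamma,
    leaves gamma^(n/2) e^(-gamma |xi|^2/2), the form treated by [convex_sqrtrX_expR]. *)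
Lemma noise_snr {R : realType} n (gamma : R)
    (A : set (n.-tuple (measurableTypeR R))) :
  0 < gamma -> measurable A ->
  (noise (Num.sqrt gamma)^-1 A = \int[@noise R n 1]_(t in A)
    (expR (enorm (vec t) ^+ 2 / 2) *
     (Num.sqrt gamma ^+ n * expR (- (enorm (vec t) ^+ 2 / 2 * gamma))))%:E)%E.
Proof.
move=> g0 mA.
pose f (x : measurableTypeR R) :=
  Num.sqrt gamma * expR (- ((gamma - 1) / 2 * x ^+ 2)).
(* The indicator of [A]: it turns the measure of [A] into an integral over the whole space. *)
pose g := (cst 1%E : n.-tuple (measurableTypeR R) -> \bar R) \_ A.
have f0 x : 0 <= f x by rewrite mulr_ge0 ?expR_ge0 ?sqrtr_ge0.
have mf : measurable_fun setT f.
  apply: measurable_funM => //; apply: measurableT_comp => //.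
  apply: measurableT_comp => //; exact: measurable_funM.
have g0' t : (0 <= g t)%E by apply: erestrict_ge0.
have mg : measurable_fun setT g by apply/(measurable_restrictT _ mA).
have -> : noise (Num.sqrt gamma)^-1 A =
    (\int[power_prob (normal_prob 0 (Num.sqrt gamma)^-1) n]_t g t)%E.
  transitivity (\int[power_prob (normal_prob 0 (Num.sqrt gamma)^-1) n]_(t in A)
    cst 1 t)%E; last exact: integral_mkcond.
  by rewrite (integral_cst _ mA) mul1e.
have step := @ge0_integral_power_prob _ _ _ (normal_prob 0 1)
  (normal_prob 0 (Num.sqrt gamma)^-1) f n f0 mf
  (fun B mB => normal_prob_snr g0 mB) g g0' mg.
apply: (etrans step).
apply: etrans (esym (integral_mkcond _ _)).
apply: eq_integral => t _.
rewrite /g !patchE; case: ifPn => _; last by rewrite mul0e.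
rewrite mul1e; congr EFin.
rewrite big_split/= prodr_const card_ord mulrCA; congr (_ * _).
rewrite -expRD -expR_sum; congr expR.
rewrite sqr_enorm !mulr_suml -sumrN -big_split/=; apply: eq_bigr => k _.
by rewrite mxE; field.
Qed.

(** * Convexity of the pairwise error probabilities and of the BER *)

Lemma convex_pep {R : realType} (n M : nat) (s : 'I_M -> 'rV[R]_n)
    (i j : 'I_M) :
  injective s -> (2 <= M)%N -> (1 <= n)%N -> i != j ->
  convex_function
    `[(n%:R + Num.sqrt (2 * n%:R)) / dmin s ^+ 2, +oo[%classic (pep s i j).
Proof.
move=> s_inj M2 n1 ij t x y /[!inE]/=; rewrite !in_itv/= !andbT => Dx Dy.
have d0 : 0 < dmin s ^+ 2 by rewrite exprn_gt0// dmin_gt0.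
(* Since n >= 1, the left endpoint of the SNR range is positive. *)
have D_gt0 z : (n%:R + Num.sqrt (2 * n%:R)) / dmin s ^+ 2 <= z -> 0 < z.
  by apply: lt_le_trans; rewrite divr_gt0// ltr_wpDr ?sqrtr_ge0// ltr0n.
have [x0 y0] := (D_gt0 _ Dx, D_gt0 _ Dy).
set xy := x <| t |> y; have xy0 : 0 < xy := convR_gt0 t x0 y0.
set A := [set xi : n.-tuple (measurableTypeR R) | voronoi s j (s i + vec xi)].
have mA : measurable A := measurable_voronoi s i j.
pose h (gamma : R) (xi : n.-tuple (measurableTypeR R)) :=
  expR (enorm (vec xi) ^+ 2 / 2) *
  (Num.sqrt gamma ^+ n * expR (- (enorm (vec xi) ^+ 2 / 2 * gamma))).
have h0 z xi : 0 <= h z xi by rewrite !mulr_ge0 ?expR_ge0 ?exprn_ge0 ?sqrtr_ge0.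
have mh z : measurable_fun A (EFin \o h z).
  have mN : measurable_fun [set: n.-tuple (measurableTypeR R)]
      (fun xi => enorm (vec xi) ^+ 2 / 2).
    by apply: measurable_funM => //; apply: measurable_funX;
      exact: measurable_enorm_vec.
  apply/measurable_funTS/measurable_EFinP; apply: measurable_funM.
    exact: measurableT_comp.
  apply: measurable_funM => //; apply: measurableT_comp => //.
  by apply: measurableT_comp => //; exact: measurable_funM.
have pepE z : 0 < z ->
    (pep s i j z)%:E = (\int[@noise R n 1]_(xi in A) (h z xi)%:E)%E.
  by move=> z0; rewrite -noise_snr// fineK// fin_num_measure.
(* With pep still visible, rewriting with pepE makes unification unfold it and
   diverge. *)
move: (pep s i j) pepE => P pepE; rewrite -lee_fin.
pose p := t%:num; pose q := 1 - p.
have p0 : 0 <= p by rewrite /p.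
have q0 : 0 <= q by rewrite subr_ge0 /p.
have -> : ((P x : R^o) <| t |> (P y : R^o))%:E =
    (p%:E * (P x)%:E + q%:E * (P y)%:E)%E.
  by rewrite -!EFinM -EFinD.
rewrite (pepE x x0) (pepE y y0) (pepE xy xy0).
(* The convex combination is brought under a single integral over [A], which does not depend on the
   SNR; a pointwise inequality then suffices. *)
rewrite -!ge0_integralZl ?lee_fin//; last 4 first.
- exact: mh.
- by move=> xi _; rewrite lee_fin.
- exact: mh.
- by move=> xi _; rewrite lee_fin.
have mph : measurable_fun A (fun xi => p%:E * (EFin \o h x) xi)%E.
  exact: measurable_funeM.
have mqh : measurable_fun A (fun xi => q%:E * (EFin \o h y) xi)%E.
  exact: measurable_funeM.
rewrite -ge0_integralD//; last 2 first.
- by move=> xi _; rewrite mule_ge0 ?lee_fin.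
- by move=> xi _; rewrite mule_ge0 ?lee_fin.
apply: ge0_le_integral => //.
- by move=> xi _; rewrite lee_fin.
- exact: mh.
- exact: emeasurable_funD mph mqh.
move=> xi Axi; rewrite -!EFinM -EFinD lee_fin /h.
rewrite [X in _ <= X + _]mulrCA [X in _ <= _ + X]mulrCA -mulrDr.
rewrite ler_wpM2l ?expR_ge0//.
(* On [A] the noise has norm at least [dmin s], so the SNR bound yields the convexity condition with
   a = |xi|^2/2. *)
have le_snr z : (n%:R + Num.sqrt (2 * n%:R)) / dmin s ^+ 2 <= z ->
    n%:R + Num.sqrt (2 * n%:R) <= 2 * (enorm (vec xi) ^+ 2 / 2) * z.
  move=> Dz; have z0 := D_gt0 _ Dz; move: Dz.
  rewrite ler_pdivrMr// => /le_trans; apply.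
  by rewrite (mulrC 2) divfK// mulrC (ler_wpM2r (ltW z0))//;
    exact: (dmin_le_voronoi ij).
exact: (@convex_sqrtrX_expR _ n (enorm (vec xi) ^+ 2 / 2) x y t x0 y0
  (le_snr _ Dx) (le_snr _ Dy)).
Qed.

Theorem corollary4p1 (R : realType) (n M : nat) (s : 'I_M -> 'rV[R]_n)
    (n_ge1 : (1 <= n)%N) (M_ge2 : (2 <= M)%N) (cs : is_constellation s) :
  let D : set R :=
    `[(n%:R + Num.sqrt (2 * n%:R)) / dmin s ^+ 2, +oo[%classic in
  (forall i j : 'I_M, i != j -> convex_function D (pep s i j)) /\
  (forall (p : 'I_M -> R) (m : nat) (b : 'I_M -> m.-tuple bool),
     is_prior p -> M = (2 ^ m)%N -> injective b ->
     convex_function D (ber s b p)).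
Proof.
have [s_inj _] := cs.
move=> D; have pep_cvx i j : i != j -> convex_function D (pep s i j).
  exact: convex_pep.
split=> // p m b [p0 _] _ _ t x y Dx Dy.
(* The BER is a combination of pairwise error probabilities with nonnegative coefficients constant
   in gamma, so convexity is checked term by term. *)
rewrite convRE /ber !mulr_sumr -big_split ler_sum// => i _.
rewrite /= !mulr_sumr -big_split ler_sum// => j ji.
rewrite /= [X in _ <= X + _]mulrCA [X in _ <= _ + X]mulrCA -mulrDr ler_wpM2l//.
  by rewrite mulr_ge0// divr_ge0.
by apply: pep_cvx; rewrite // eq_sym.
Qed.
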